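(* Let $\{R_\lambda\}_{\lambda\in\Lambda}$ be a family of nonzero commutative rings with identity indexed by an infinite set $\Lambda$, and let $R=\prod_{\lambda\in\Lambda}R_\lambda$. Then $|\mathrm{Max}(R)|\geqslant 2^{2^{|\Lambda|}}$.
   Context: $\mathrm{Max}(R)$ denotes the set of all maximal ideals of $R$, and $|\cdot|$ denotes cardinality. *)

(* Defs.v *)
From HB Require Import structures.
From mathcomp Require Import all_boot all_algebra.
From mathcomp Require Import all_classical.

Set Implicit Arguments.
Unset Strict Implicit.
Unset Printing Implicit Defensive.

Import GRing.Theory.

Local Open Scope classical_set_scope.
Local Open Scope ring_scope.

(* MathComp only puts a ring structure on non-dependent functions T -> M, hence
   this alias for the dependent product, with the pointwise operations. *)
Definition prod_ring (L : Type) (R : L -> comNzRingType) : Type :=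
  forall l, R l.

Section ProdRing.
Variables (L : Type) (R : L -> comNzRingType).
Implicit Types f g h : prod_ring R.

HB.instance Definition _ := Choice.copy (prod_ring R) (forall l, R l).

Let zero : prod_ring R := fun=> 0.
Let one : prod_ring R := fun=> 1.
Let opp f : prod_ring R := fun l => - f l.
Let add f g : prod_ring R := fun l => f l + g l.
Let mul f g : prod_ring R := fun l => f l * g l.

Let addA : associative add.
Proof. by move=> f g h; apply: functional_extensionality_dep => l; apply: addrA. Qed.

Let addC : commutative add.
Proof. by move=> f g; apply: functional_extensionality_dep => l; apply: addrC. Qed.

Let add0 : left_id zero add.
Proof. by move=> f; apply: functional_extensionality_dep => l; apply: add0r. Qed.

Let addN : left_inverse zero opp add.
Proof. by move=> f; apply: functional_extensionality_dep => l; apply: addNr. Qed.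

HB.instance Definition _ :=
  GRing.isZmodule.Build (prod_ring R) addA addC add0 addN.

Let mulA : associative mul.
Proof. by move=> f g h; apply: functional_extensionality_dep => l; apply: mulrA. Qed.

Let mulC : commutative mul.
Proof. by move=> f g; apply: functional_extensionality_dep => l; apply: mulrC. Qed.

Let mul1 : left_id one mul.
Proof. by move=> f; apply: functional_extensionality_dep => l; apply: mul1r. Qed.

Let mulDl : left_distributive mul add.
Proof. by move=> f g h; apply: functional_extensionality_dep => l; apply: mulrDl. Qed.

HB.instance Definition _ :=
  GRing.Zmodule_isComPzRing.Build (prod_ring R) mulA mulC mul1 mulDl.

End ProdRing.

Lemma prod_ringE (L : Type) (R : L -> comNzRingType) (f g : prod_ring R) l :
  ((0 : prod_ring R) l = 0) * ((1 : prod_ring R) l = 1) *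
  ((- f) l = - f l) * ((f + g) l = f l + g l) * ((f * g) l = f l * g l).
Proof. by []. Qed.

(* The ideals of ring_quotient (idealr_closed) are proper by definition and
   require 1 != 0, which fails in a product over an empty index type. *)
Definition ideal (R : comPzRingType) (I : set R) : Prop :=
  [/\ I 0, forall x y, I x -> I y -> I (x + y) & forall a x, I x -> I (a * x)].

Definition maximal_ideal (R : comPzRingType) (M : set R) : Prop :=
  [/\ ideal M, M <> setT &
      forall J : set R, ideal J -> M `<=` J -> J = M \/ J = setT].

Definition Max (R : comPzRingType) : set (set R) :=
  [set M | maximal_ideal M].

Lemma idealr_closedE (R : comNzRingType) (I : set R) :
  idealr_closed (mem I) <-> ideal I /\ I <> setT.
Proof.
split=> [[I0 I1 IM]|[[I0 ID IM] IT]].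
  have {}I0 : I 0 by exact: set_mem I0.
  have {}IM a x y : I x -> I y -> I (a * x + y).
    by move=> Ix Iy; apply: set_mem; apply: IM; apply: mem_set.
  split; last by move=> IT; move/negP: I1; apply; apply: mem_set; rewrite IT.
  split=> // [x y Ix Iy|a x Ix]; first by rewrite -[x]mul1r; exact: IM.
  by rewrite -[a * x]addr0; exact: IM.
split; first exact: mem_set.
- apply/negP => /set_mem I1; apply: IT; apply/seteqP; split=> // x _.
  by rewrite -[x]mulr1; exact: IM.
- move=> a x y /set_mem Ix /set_mem Iy; apply: mem_set.
  by apply: ID => //; exact: IM.
Qed.

(* Main.v *)
Require Import Defs.
From mathcomp Require Import all_boot all_algebra.
From mathcomp Require Import all_classical.

Import GRing.Theory.

(** An infinite set T of cardinality kappa carries an independent family of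
    2 ^ kappa subsets A X (X a subset of T): every finite system of conditions
    l \in A X or l \notin A X, for distinct X, has a solution l (the theorem
    of Fichtenholz, Kantorovich and Hausdorff, [independent_family]). For a set
    G of subsets of T, let I G be the set of those elements of the product
    ring that vanish at all l solving the conditions
    l \in A X <-> X \in G for X in some finite list. It is an ideal, and
    independence says exactly that 1 is not in it, because every factor is
    nonzero; so it lies in a maximal ideal M G ([ideal_sub_Max]). If X is in G
    but not in H, then the idempotent that is 0 on A X and 1 elsewhere is in
    I G and its complement is in I H; they add up to 1, so M G <> M H. Thus
    G |-> M G is injective on the 2 ^ 2 ^ kappa sets G.

    For the independent family, let A X consist of the pairs (F, S) of a
    finite list F of points and a finite list S of lists such that the sublist
    of F formed by its points in X belongs to S. Given finitely many X, a list
    F that separates them ([separating_seq]) lets S prescribe freely which of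
    the A X contain (F, S). Such pairs are finite lists of finite lists over
    T, and they can be taken for elements of T because finite lists over an
    infinite T inject into T ([infinite_seq_inj]).

    That last fact comes from Zorn's lemma on pairs (A, f) of a nonempty
    subset A of T and an injective coding f of lists over A by elements of A.
    A coding of lists over A also codes lists of lists, hence lists over any
    set that is at most the union of two copies of A ([recode_inj]). In a
    maximal pair, A is at least as large as its complement: otherwise a copy
    of A in the complement could be added to A, with room for the new codes.
    Hence T is at most two copies of A, and lists over T can be coded. *)

Local Open Scope classical_set_scope.
Local Open Scope card_scope.

(** * Comparability of cardinals *)

Lemma set_inj_of_graph (T : Type) (U : pointedType) (A : set T) (B : set U)
    (G : set (T * U)) :
  (forall x, A x -> exists2 y, B y & G (x, y)) ->
  (forall x x' y, G (x, y) -> G (x', y) -> x = x') ->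
  A #<= B.
Proof.
move=> AG injG.
have /choice[f fP] x : exists y, A x -> B y /\ G (x, y).
  case: (pselect (A x)) => [/AG[y By Gxy]|nAx]; first by exists y.
  by exists point.
apply/pcard_leP/injfunPex; exists f => [x /fP[]//|x x' /set_mem/fP[_ Gx]].
by move=> /set_mem/fP[_ Gx'] eqf; apply: injG Gx _; rewrite eqf.
Qed.

(** A partial injection from A to B that is maximal under inclusion of graphs
    cannot leave out both a point of A and a point of B. *)
Lemma card_le_total {T U : pointedType} (A : set T) (B : set U) :
  A #<= B \/ B #<= A.
Proof.
pose P (G : set (T * U)) := [/\ G `<=` A `*` B,
  (forall x x' y, G (x, y) -> G (x', y) -> x = x') &
  (forall x y y', G (x, y) -> G (x, y') -> y = y')].
have [F FP Ftot|G [[GAB Ginj Gfun] Gmax]] := @Zorn_bigcup _ P.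
  have F2 p q : (\bigcup_(X in F) X) p -> (\bigcup_(X in F) X) q ->
      exists2 X, F X & X p /\ X q.
    move=> [X FX Xp] [Y FY Yq].
    by have [XY|YX] := Ftot _ _ FX FY; [exists Y | exists X];
      do ?split; auto.
  split=> [p [X FX Xp]|x x' y Gx Gx'|x y y' Gy Gy'].
  - by case: (FP _ FX) => + _ _; apply.
  - by have [X FX []] := F2 _ _ Gx Gx'; case: (FP _ FX) => _ + _; apply.
  - by have [X FX []] := F2 _ _ Gy Gy'; case: (FP _ FX) => _ _; apply.
have [AG|] := pselect (forall x, A x -> exists2 y, B y & G (x, y)).
  by left; exact: set_inj_of_graph Ginj.
have [BG _|] := pselect (forall y, B y -> exists2 x, A x & G (x, y)).
  right; apply: (@set_inj_of_graph _ _ _ _ [set p | G (p.2, p.1)]) => //=.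
  by move=> y y' x; exact: Gfun.
move=> /existsNP[b /not_implyP[Bb nGb]] /existsNP[a /not_implyP[Aa nGa]].
have Ga y : ~ G (a, y).
  by move=> Gay; apply: nGa; exists y => //; case: (GAB _ Gay).
have Gb x : ~ G (x, b).
  by move=> Gxb; apply: nGb; exists x => //; case: (GAB _ Gxb).
exfalso; apply: (Gmax (G `|` [set (a, b)])).
  by split; [exact: subsetUl | move=> /(_ (a, b)) /(_ (or_intror erefl))/Ga].
split.
- by move=> p [/GAB//|->].
- move=> x x' y [Gx|[-> ->]] [Gx'|[]].
  + exact: Ginj Gx Gx'.
  + by move=> _ yb; move: Gx; rewrite yb => /Gb.
  + by case/Gb: Gx'.
  + by move=> ->.
- move=> x y y' [Gx|[-> ->]] [Gx'|[]].
  + exact: Gfun Gx Gx'.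
  + by move=> xa _; move: Gx; rewrite xa => /Ga.
  + by case/Ga: Gx'.
  + by move=> ->.
Qed.

(** * Finite sequences over an infinite type *)

(** The values of [code] on lists that are not over [carrier] are junk; they
    are ignored by the order [code_le]. *)
Record seq_code (T : eqType) := SeqCode {
  carrier : set T;
  code : seq T -> T;
  carrier_neq0 : carrier !=set0;
  code_in : forall s, [set` s] `<=` carrier -> carrier (code s);
  code_inj : forall s t, [set` s] `<=` carrier -> [set` t] `<=` carrier ->
    code s = code t -> s = t }.

Arguments carrier {T} _.
Arguments code {T} _ _.
Arguments carrier_neq0 {T} _.
Arguments code_in {T _ _}.
Arguments code_inj {T _ _ _}.
Arguments SeqCode {T}.

Lemma subset_map (T U : eqType) (A : set T) (B : set U) (f : T -> U) s :
  (forall x, A x -> B (f x)) -> [set` s] `<=` A -> [set` map f s] `<=` B.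
Proof. by move=> fAB sA _ /= /mapP[x xs ->]; apply/fAB/sA. Qed.

Lemma set_inj_map {T U : eqType} (A : set T) {f : T -> U} :
  (forall x y, A x -> A y -> f x = f y -> x = y) ->
  forall s t, [set` s] `<=` A -> [set` t] `<=` A -> map f s = map f t -> s = t.
Proof.
move=> finj; elim=> [|x s IH] [|y t]//= sA tA [fxy fst].
congr (_ :: _).
  by apply: finj => //; [apply: sA | apply: tA]; rewrite /= mem_head.
by apply: IH => // z zs; [apply: sA | apply: tA]; rewrite /= inE zs orbT.
Qed.

Definition code_le {T : eqType} (c d : seq_code T) : Prop :=
  carrier c `<=` carrier d /\
  forall s, [set` s] `<=` carrier c -> code c s = code d s.

(** The starting point for Zorn's lemma: lists over a copy of nat are
    countable. *)
Lemma nat_seq_code (T : pointedType) :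
  infinite_set [set: T] -> seq_code T.
Proof.
move=> /infiniteP /pcard_leP/unsquash i.
have iinj : injective i by move=> m n; apply: 'inj_i; rewrite inE.
pose dec x := xget 0%N [set n | i n = x].
have decK n : dec (i n) = n.
  by apply: iinj; rewrite /dec; case: xgetP => [m _ //|/(_ n) []].
apply: (SeqCode (range i) (fun s => i (pickle (map dec s)))).
- by exists (i 0%N), 0%N.
- by move=> s _; exists (pickle (map dec s)).
- move=> s t si ti /iinj/(pcan_inj pickleK).
  apply: (set_inj_map (range i)) => //.
  by move=> _ _ [m _ <-] [n _ <-]; rewrite !decK => ->.
Qed.

(** A list is finite, so a list over the union of a chain is already a list
    over one of its members; it is coded as there, and any two members that can
    code it agree. *)
Lemma code_chain_ub {T : eqType} (C : set (seq_code T)) :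
  C !=set0 -> total_on C (@code_le _) ->
  exists d, forall c, C c -> code_le c d.
Proof.
move=> [c0 Cc0] Ctot; pose A := \bigcup_(c in C) carrier c.
have agree c d (s : seq T) : C c -> C d -> [set` s] `<=` carrier c ->
    [set` s] `<=` carrier d -> code c s = code d s.
  by move=> Cc Cd sc sd; have [[_ ->]//|[_ ->]//] := Ctot _ _ Cc Cd.
have supp (s : seq T) : [set` s] `<=` A ->
    exists2 c, C c & [set` s] `<=` carrier c.
  elim: s => [|x s IH] sA; first by exists c0 => // z /=; rewrite in_nil.
  have sA' : [set` s] `<=` A.
    by move=> z /= zs; apply: sA; rewrite /= inE zs orbT.
  have [d Cd sd] := IH sA'.
  have [c Cc xc] : A x by apply: sA; rewrite /= mem_head.
  have [[cd _]|[dc _]] := Ctot _ _ Cc Cd; [exists d|exists c] => //= z /=;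
    rewrite inE => /orP[/eqP->|zs]; auto.
have /choice[pick pickP] (s : seq T) : exists c, [set` s] `<=` A ->
    C c /\ [set` s] `<=` carrier c.
  case: (pselect ([set` s] `<=` A)) => [/supp[c Cc sc]|nsA]; first by exists c.
  by exists c0.
unshelve eexists (SeqCode A (fun s => code (pick s) s) _ _ _).
- by have [x cx] := carrier_neq0 c0; exists x, c0.
- move=> s /pickP[Cp sp]; exists (pick s) => //; exact: code_in.
- move=> s t /pickP[Cs ss] /pickP[Ct tt].
  have [[st _]|[ts _]] := Ctot _ _ Cs Ct.
    rewrite (agree _ _ s Cs Ct) //; last exact: subset_trans st.
    by apply: code_inj => //; exact: subset_trans st.
  rewrite (agree _ _ t Ct Cs) //; last exact: subset_trans ts.
  by apply: code_inj => //; exact: subset_trans ts.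
- move=> c Cc; split=> /= [x cx|s sc]; first by exists c.
  have [Cp sp] : C (pick s) /\ [set` s] `<=` carrier (pick s).
    by apply: pickP => x /sc cx; exists c.
  exact: agree.
Qed.

(** Two disjoint copies of A inside the lists over A: points of A become lists
    of length 2, and the others, sent into A by h, lists of length 1. *)
Definition two_copies {T : eqType} (A : set T) (h : T -> T) (x : T) : seq T :=
  if x \in A then [:: x; x] else [:: h x].

Lemma two_copies_sub {T : eqType} {A B : set T} {h : T -> T} {x} :
  (forall x, B x -> ~ A x -> A (h x)) -> B x -> [set` two_copies A h x] `<=` A.
Proof.
rewrite /two_copies => hA Bx z; case: ifPn => /=.
  by move=> /set_mem Ax; rewrite !inE orbb => /eqP->.
by move=> /negP xA; rewrite inE => /eqP ->; apply: hA => // /mem_set.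
Qed.

(** If the points of B outside A inject into A, then points of B can be written
    as lists over A, lists over B as lists of lists over A, and the latter are
    coded by applying the code of A twice. *)
Lemma recode_inj {T : eqType} (c : seq_code T) (B : set T) (h : T -> T) :
  let A := carrier c in
  (forall x, B x -> ~ A x -> A (h x)) ->
  (forall x y, B x -> B y -> ~ A x -> ~ A y -> h x = h y -> x = y) ->
  let f s := code c (map (fun x => code c (two_copies A h x)) s) in
  (forall s, [set` s] `<=` B -> A (f s)) /\
  (forall s t, [set` s] `<=` B -> [set` t] `<=` B -> f s = f t -> s = t).
Proof.
move=> A hA hinj f.
have cA x : B x -> A (code c (two_copies A h x)).
  by move=> Bx; apply: code_in; exact: two_copies_sub Bx.
have cs s : [set` s] `<=` B ->
    [set` map (fun x => code c (two_copies A h x)) s] `<=` A.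
  exact: subset_map.
split=> [s sB|s t sB tB /code_inj]; first by apply: code_in; exact: cs.
move=> /(_ (cs _ sB) (cs _ tB)); apply: (set_inj_map B) => // x y Bx By.
move=> /code_inj.
move=> /(_ (two_copies_sub hA Bx) (two_copies_sub hA By)).
rewrite /two_copies; case: ifPn => xA; case: ifPn => yA //.
  by case.
case; apply: hinj => //.
  by move=> Ax; move/negP: xA; apply; exact: mem_set.
by move=> Ay; move/negP: yA; apply; exact: mem_set.
Qed.

(** For a maximal coding c with carrier A, suppose first that A embeds by h in
    its complement. Lists over B = A \cup h(A) have codes in A by
    [recode_inj]; keeping the old codes on lists over A and moving the others
    to h(A) keeps the two kinds apart, and this coding on B is a proper
    extension of c. So the complement embeds in A, and [recode_inj] applies to
    the whole of T. *)
Lemma infinite_seq_inj (T : Type) : infinite_set [set: T] ->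
  exists f : seq T -> T, injective f.
Proof.
elim/Ppointed: T => T Tinf.
  by exfalso; apply: Tinf; rewrite emptyE; exact: finite_set0.
pose R (c d : seq_code T) := `[< code_le c d >].
have [||F Ftot|c cmax] := @ZL_preorder _ (nat_seq_code T Tinf) R.
- by move=> c; apply/asboolP; split.
- move=> c d e /asboolP[cd cdE] /asboolP[de deE]; apply/asboolP; split.
    exact: subset_trans de.
  by move=> s sc; rewrite cdE// deE//; exact: subset_trans cd.
- have [->|/set0P F0] := eqVneq F set0; first by exists (nat_seq_code T Tinf).
  have [|d dP] := code_chain_ub F F0; last first.
    by exists d => c /dP ?; exact/asboolP.
  by move=> c d Fc Fd; have [/asboolP|/asboolP] := Ftot _ _ Fc Fd; [left|right].
pose A := carrier c.
have [AC|CA] := card_le_total A (~` A).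
  have /pcard_leP/injfunPex[h hA hinj] := AC.
  have hinj' x y : A x -> A y -> h x = h y -> x = y.
    by move=> Ax Ay; apply: hinj; exact: mem_set.
  pose B := A `|` h @` A.
  (* The inverse of h on its image. *)
  pose g y := xget point [set x | A x /\ h x = y].
  have gP y : (h @` A) y -> A (g y) /\ h (g y) = y.
    by move=> [x Ax hx]; rewrite /g; case: xgetP => [_ -> []//|/(_ x) []].
  have [||fA finj] := recode_inj c B g.
  - by move=> x [//|/gP[]].
  - move=> x y [Ax|/gP[_ hx]] [Ay|/gP[_ hy]] nAx nAy gxy //.
    by rewrite -hx -hy gxy.
  set f := (X in forall s t, _ -> _ -> X s = X t -> s = t) in finj.
  pose f' s := if `[< [set` s] `<=` A >] then code c s else h (f s).
  have f'in s : [set` s] `<=` B -> B (f' s).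
    move=> sB; rewrite /f'; case: asboolP => sA; first by left; exact: code_in.
    by right; exists (f s) => //; exact: fA.
  have f'inj s t : [set` s] `<=` B -> [set` t] `<=` B -> f' s = f' t -> s = t.
    move=> sB tB; rewrite /f'.
    case: asboolP => sA; case: asboolP => tA.
    - exact: code_inj.
    - by move=> e; case: (hA _ (fA _ tB)); rewrite -e; exact: code_in.
    - by move=> e; case: (hA _ (fA _ sB)); rewrite e; exact: code_in.
    - by move=> /(hinj' _ _ (fA _ sB) (fA _ tB)); exact: finj.
  have [a Aa] := carrier_neq0 c.
  have B0 : B !=set0 by exists a; left.
  have /asboolP[BA _] : R (SeqCode B f' B0 f'in f'inj) c.
    apply: cmax; apply/asboolP; split=> [x Ax|s sA]; first by left.
    by rewrite /= /f' asboolT.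
  by case: (hA _ Aa); apply: BA; right; exists a.
have /pcard_leP/injfunPex[h hA hinj] := CA.
have [] := recode_inj c [set: T] h.
- by move=> x _; exact: hA.
- by move=> x y _ _ nAx nAy; apply: hinj; exact: mem_set.
move=> _ finj; eexists => s t; exact: finj.
Qed.

(** * Independent families of subsets *)

(** It is enough that F contains, for any two distinct sets of the list, a point
    that lies in just one of them. *)
Lemma separating_seq (T : pointedType) (Xs : seq (set T)) :
  exists F : seq T, forall X Y, X \in Xs -> Y \in Xs ->
    [seq x <- F | x \in X] = [seq x <- F | x \in Y] -> X = Y.
Proof.
(* A point where X and Y differ, if there is one. *)
pose d (X Y : set T) := xget point [set x | ~ (X x <-> Y x)].
exists [seq d X Y | X <- Xs, Y <- Xs] => X Y XXs YXs eqF.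
apply: contrapT => neqXY.
have dXY : ~ (X (d X Y) <-> Y (d X Y)).
  rewrite /d; case: xgetP => [_ -> //|same] _.
  apply: neqXY; apply/funext => x; apply/propext.
  by apply: contrapT; exact: same.
have dF : d X Y \in [seq d X Y | X <- Xs, Y <- Xs].
  by apply/allpairsP; exists (X, Y).
have := congr1 (fun s => d X Y \in s) eqF.
rewrite !mem_filter dF !andbT => e.
by apply: dXY; split=> /mem_set; [rewrite e|rewrite -e] => /set_mem.
Qed.

(** For X in Xs, the sublist of F in X determines X, so taking for
    S the sublists that come from the members of Xs in G puts the point (F, S)
    in A X exactly when X is in G. *)
Lemma independent_family (T : Type) : infinite_set [set: T] ->
  exists A : set T -> set T, forall (Xs : seq (set T)) (G : set (set T)),
    exists l, forall X, X \in Xs -> (A X l <-> G X).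
Proof.
elim/Ppointed: T => T Tinf.
  by exfalso; apply: Tinf; rewrite emptyE; exact: finite_set0.
have [f finj] := infinite_seq_inj T Tinf.
pose j (F : seq T) (S : seq (seq T)) := f (map f (F :: S)).
pose A (X : set T) := [set l | exists F S,
  j F S = l /\ [seq x <- F | x \in X] \in S].
exists A => Xs G; have [F Fsep] := separating_seq T Xs.
exists (j F [seq [seq x <- F | x \in X] | X : set T <- Xs & X \in G]) => X XXs.
split=> [[F' [S []]]|GX]; last first.
  exists F; eexists; split; first by [].
  by apply/mapP; exists X => //; rewrite mem_filter XXs mem_set.
move=> /finj[/finj -> /(inj_map finj) ->] /mapP[Y].
by rewrite mem_filter => /andP[/set_mem GY YXs] /Fsep ->.
Qed.

(** * Maximal ideals *)

Section MaximalIdeals.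
Local Open Scope ring_scope.

(** Zorn's lemma is applied to the sets J such that I `|` J is a proper ideal,
    rather than to the proper ideals that contain I, so that the union of the
    empty chain is admissible. *)
Lemma ideal_sub_Max {R : comPzRingType} {I : set R} :
  ideal I -> ~ I 1 -> exists2 M, @Max R M & I `<=` M.
Proof.
move=> idI I1; pose P J := ideal (I `|` J) /\ ~ (I `|` J) 1.
have [F FP Ftot|J [[idJ J1] Jmax]] := @Zorn_bigcup _ P.
  have [->|/set0P[J0 FJ0]] := eqVneq F set0.
    by rewrite bigcup_set0 /P setU0.
  have cover x : (I `|` \bigcup_(J in F) J) x -> exists2 J, F J & (I `|` J) x.
    by move=> [Ix|[J FJ Jx]]; [exists J0 => //; left|exists J => //; right].
  have sub J x : F J -> (I `|` J) x -> (I `|` \bigcup_(J in F) J) x.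
    by move=> FJ [Ix|Jx]; [left|right; exists J].
  split; last by move=> /cover[J FJ]; exact: (FP _ FJ).2.
  split=> [|x y /cover[J FJ Jx] /cover[K FK Ky]|a x /cover[J FJ Jx]].
  - by left; case: idI.
  - have [JK|KJ] := Ftot _ _ FJ FK.
      apply: (sub K) => //; have [[_ KD _] _] := FP _ FK.
      by apply: KD => //; exact: setUS Jx.
    apply: (sub J) => //; have [[_ JD _] _] := FP _ FJ.
    by apply: JD => //; exact: setUS Ky.
  - by apply: (sub J) => //; have [[_ _ JM] _] := FP _ FJ; exact: JM.
exists (I `|` J); last exact: subsetUl.
split=> // [JT|K idK JK]; first by apply: J1; rewrite JT.
have [K1|nK1] := pselect (K 1).
  right; apply/seteqP; split=> // x _.
  by case: idK => _ _ KM; rewrite -[x]mulr1; exact: KM.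
left; apply: contrapT => neq; apply: (Jmax K).
  split; first by move=> x Jx; apply: JK; right.
  by move=> KJ; apply: neq; apply/seteqP; split=> // x /KJ; right.
have IK : I `<=` K by move=> x Ix; apply: JK; left.
by rewrite /P ((setUidPr _ _).2 IK).
Qed.

End MaximalIdeals.

Theorem theorem3p10 (Lambda : Type) (R : Lambda -> comNzRingType) :
  infinite_set [set: Lambda] ->
  [set: set (set Lambda)] #<= @Max (prod_ring R).
Proof.
move=> /independent_family[A indep].
pose cell (G : set (set Lambda)) (Xs : seq (set Lambda)) : set Lambda :=
  [set l | forall X, X \in Xs -> (A X l <-> G X)].
pose I (G : set (set Lambda)) : set (prod_ring R) :=
  [set r | exists Xs, forall l, cell G Xs l -> r l = 0%R].
have cell_cat G Xs Ys l : cell G (Xs ++ Ys) l -> cell G Xs l /\ cell G Ys l.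
  by move=> cl; split=> X XXs; apply: cl; rewrite mem_cat XXs ?orbT.
have idI G : ideal (I G).
  split=> [|r s [Xs rXs] [Ys sYs]|a r [Xs rXs]]; first by exists [::].
    exists (Xs ++ Ys) => l /cell_cat[/rXs rl /sYs sl].
    by rewrite prod_ringE rl sl addr0.
  by exists Xs => l /rXs rl; rewrite prod_ringE rl mulr0.
have I1 G : ~ I G 1%R.
  move=> [Xs oneXs]; have [l /oneXs one0] := indep Xs G.
  by have /eqP := oner_neq0 (R l).
have /choice[M MP] G : exists M, @Max (prod_ring R) M /\ I G `<=` M.
  by have [M] := ideal_sub_Max (idI G) (I1 G); exists M.
have M_inj G H X : M G = M H -> G X -> H X.
  move=> eqM GX; apply: contrapT => nHX.
  pose e : prod_ring R := fun l => if `[< A X l >] then 0%R else 1%R.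
  have Ge : I G e.
    exists [:: X] => l /(_ X (mem_head _ _)) AG.
    by rewrite /e asboolT //; exact/AG.
  have He : I H (1 - e)%R.
    exists [:: X] => l /(_ X (mem_head _ _)) AH.
    change (1 - e l = 0)%R.
    by rewrite /e asboolF ?subrr // => /AH.
  have [[[_ MD MM] MT _] IM] := MP G.
  apply: MT; apply/seteqP; split=> // r _; rewrite -[r]mulr1 -(subrKC e 1%R).
  apply: MM; apply: MD; first exact: IM.
  by rewrite eqM; case: (MP H) => _; exact.
apply/pcard_leP/injfunPex; exists M => [G _|G H _ _ eqM].
  by case: (MP G).
apply/seteqP; split=> X; first exact: M_inj.
by apply: M_inj; rewrite eqM.
Qed.
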